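(* Let the edge passage times $X_e$ be i.i.d. positive random variables with tail probability function $H(x)=\mathbb{P}(X_e>x)$, and suppose that the essential supremum $\mu=\inf\{x:\mathbb{P}(X_e>x)=0\}$ of $X_e$ equals $\infty$. Let $f$ and $g$ be two real-valued functions such that $H(f(n))=\frac{\ln n}{n}$ for all sufficiently large integers $n$, and $n^2H(g(n))\to0$ as $n\to\infty$. Then for any $\epsilon>0$, $$\lim_{n\to\infty}\mathbb{P}\left((1-\epsilon)f(n)\le\frac{W_n}{n}\le g(n)\right)=1 .$$
   Context: Last passage percolation on the complete graph. $G_n=([n],E_n)$ is the complete graph on $[n]=\{1,\dots,n\}$, with $E_n=\{\langle i,j\rangle:1\le i<j\le n\}$. Each edge $e\in E_n$ carries a positive random passage time $X_e$, and $\{X_e:e\in E_n\}$ are independent and identically distributed, with a common law not depending on $n$. For $n\ge2$, $\Pi_{1,n}$ is the set of all self-avoiding paths in $G_n$ from vertex $1$ to vertex $n$ (no repeated vertices). The passage time of a path $\pi$ is $T(\pi)=\sum_{e\in\pi}X_e$, and $W_n=\sup_{\pi\in\Pi_{1,n}}T(\pi)$. *)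

(* Defs.v *)
From HB Require Import structures.
From mathcomp Require Import all_boot all_order all_algebra.
From mathcomp Require Import all_classical all_reals all_analysis.

Set Implicit Arguments.
Unset Strict Implicit.
Unset Printing Implicit Defensive.

Import Order.TTheory GRing.Theory Num.Theory.
Import numFieldNormedType.Exports.

Local Open Scope classical_set_scope.
Local Open Scope ring_scope.

(** The vertex [k] of the complete graph on [{1, ..., n}] is encoded by the
    ordinal of value [k - 1]. *)

Definition edge (n : nat) : finType := {e : 'I_n * 'I_n | (e.1 < e.2)%N}.

Definition complete_adj (n : nat) : rel 'I_n := fun i j => i != j.
Arguments complete_adj n _ _ : clear implicits.

(** A path is the sequence of its vertices; the value tests on the first and
    last vertices make the definition meaningful for every [n]. *)
Definition self_avoiding (n : nat) : set (seq 'I_n) :=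
  [set s | exists x p, [/\ s = x :: p, nat_of_ord x = 0,
     nat_of_ord (last x p) = n.-1, path (complete_adj n) x p & uniq s]].
Arguments self_avoiding n _ : clear implicits.

Definition path_edges (n : nat) (s : seq 'I_n) : {set edge n} :=
  [set e : edge n |
     let: (i, j) := val e in
     ((i, j) \in zip s (behead s)) || ((j, i) \in zip s (behead s))]%SET.

Definition passage_time (R : realType) (n : nat) (t : edge n -> R)
    (s : seq 'I_n) : R :=
  \sum_(e in path_edges s) t e.

(** For [n >= 2] this is the supremum of a nonempty finite set. *)
Definition last_passage_time (R : realType) (n : nat) (t : edge n -> R) : R :=
  sup [set passage_time t s | s in self_avoiding n].

Definition mutually_independent (R : realType) (d : measure_display)
    (T : measurableType d) (P : probability T R) (I : finType)
    (X : I -> {RV P >-> R}) : Prop :=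
  forall (J : {set I}) (B : I -> set R), (forall i, measurable (B i)) ->
    P (\bigcap_(i in [set` J]) (X i @^-1` B i))
    = (\prod_(i in J) P (X i @^-1` B i))%E.

(** Equality of laws, for variables living on possibly different spaces. *)
Definition same_law (R : realType) (d d' : measure_display)
    (T : measurableType d) (T' : measurableType d')
    (P : probability T R) (P' : probability T' R)
    (X : {RV P >-> R}) (Y : {RV P' >-> R}) : Prop :=
  forall A : set R, measurable A -> distribution P X A = distribution P' Y A.

(* Main.v *)
(** Lower bound: call an edge heavy when its weight exceeds [f n]. If every two
    disjoint sets of [k] vertices are joined by a heavy edge, depth-first search
    yields a heavy path through at least [n - 1 - 2k] vertices other than the two
    endpoints, and in the complete graph this path can be joined to both of them.
    With [k = floor (eps n / 4)] the hypothesis fails with probability at most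
    [4^n (1 - ln n / n)^(k^2)], which is superexponentially small.
    Upper bound: by a union bound no edge weight exceeds [g n], and a
    self-avoiding path has fewer than [n] edges. *)

Require Import Defs.
From HB Require Import structures.
From mathcomp Require Import all_boot all_order all_algebra.
From mathcomp Require Import all_classical all_reals all_analysis.
From mathcomp Require Import measurable_realfun ring lra zify.

Set Implicit Arguments.
Unset Strict Implicit.
Unset Printing Implicit Defensive.

Import Order.TTheory GRing.Theory Num.Theory.
Import numFieldNormedType.Exports.

Local Open Scope classical_set_scope.
Local Open Scope ring_scope.

(** * Long paths from depth-first search *)

(** Depth-first search: [s] holds the finished vertices, [p] the stack (its head
    is the current vertex), [u] the unvisited vertices. No edge joins [s] to [u],
    and each step decreases [size u - size s] by exactly one. *)
Lemma dfs_balanced (T : eqType) (r : rel T) (r_sym : symmetric r)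
    (s p u : seq T) :
  allrel (fun x y => ~~ r x y) s u -> sorted r p -> (size s <= size u)%N ->
  exists s' p' u', [/\ perm_eq (s' ++ p' ++ u') (s ++ p ++ u),
    allrel (fun x y => ~~ r x y) s' u', sorted r p' & size s' = size u'].
Proof.
move=> + + /subnKC; move: (size u - size s)%N => k.
elim: k => [|k IHk] in s p u *; first by rewrite addn0 => *; exists s, p, u.
case: p => [|x p].
  (* With an empty stack the search restarts from any unvisited vertex; one exists because [u] is
     larger than [s]. *)
  case: u => [|y u]; first by rewrite addnS.
  move=> su _ [uE]; apply: (IHk s [:: y] u) => //; last by move: uE => /=; lia.
  by move: su; rewrite allrel_consr => /andP[].
move=> su px uE; have [/hasP[y yu rxy]|xu] := boolP (has (r x) u).
  have /perm_to_rem yE := yu.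
  have [|/=||s' [p' [u' [sE ? ? ?]]]] := IHk s (y :: x :: p) (rem y u).
  - apply/allrelP => a b sa /mem_rem ub; exact: (allrelP su).
  - by rewrite r_sym rxy.
  - by rewrite size_rem//; lia.
  - exists s', p', u'; split => //; apply: perm_trans sE _.
    rewrite perm_cat2l perm_sym /=; apply: perm_trans (_ : perm_eq _ ((x :: p) ++ y :: rem y u)) _.
      by rewrite (perm_cat2l (x :: p)).
    by apply/permPl; exact: (perm_catCA (x :: p) [:: y]).
(* No unvisited neighbour is left, so [x] can be declared finished without creating an edge from [s]
   to [u]. *)
have [||/=|s' [p' [u' [sE ? ? ?]]]] := IHk (x :: s) p u.
- by rewrite allrel_consl su andbT all_predC.
- exact: path_sorted px.
- lia.
- exists s', p', u'; split => //; apply: perm_trans sE _ => /=.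
  by apply/permPl; exact: (perm_catCA [:: x] s).
Qed.

(** At the balanced moment the finished and unvisited sets have equal size and no edge between them,
    so density forces that size below [k]; all remaining vertices of [V] lie on the stack, which is
    the path. *)
Lemma dfs_long_path (T : finType) (r : rel T) (V : {set T}) (k : nat) :
  symmetric r ->
  (forall A B : {set T}, {in A, forall x, x \notin B} -> #|A| = k -> #|B| = k ->
    exists a b, [/\ a \in A, b \in B & r a b]) ->
  exists p, [/\ uniq p, {subset p <= V}, sorted r p & (#|V| < size p + 2 * k)%N].
Proof.
move=> r_sym r_dense.
have [//|//|//|s [p [u [sE su rp suE]]]] := @dfs_balanced T r r_sym [::] [::] (enum V).
have := perm_uniq sE; rewrite /= enum_uniq !cat_uniq => /and5P[us hs up hp uu].
exists p; split => //.
  by move=> x xp; rewrite -mem_enum -(perm_mem sE) !mem_cat xp orbT.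
have := perm_size sE; rewrite /= !size_cat -cardE ltnNge suE => <-.
apply/negP => kle.
have ks : (k <= size u)%N.
  by move: kle; rewrite addnCA addnn -mul2n leq_add2l leq_pmul2l.
have inj_take (v : seq T) : uniq v -> (k <= size v)%N ->
    #|[set x in take k v]%SET| = k.
  by move=> uv kv; rewrite cardsE (card_uniqP _) ?take_uniq// size_takel.
have [|||a [b []]] := r_dense [set x in take k s]%SET [set x in take k u]%SET.
- move=> x; rewrite !inE => /mem_take xs; apply/negP => /mem_take xu.
  by case/negP: hs; apply/hasP; exists x; rewrite // mem_cat xu orbT.
- by apply: inj_take; rewrite // suE.
- exact: inj_take.
- rewrite !inE => /mem_take aS /mem_take bU.
  by rewrite (negbTE (allrelP su _ _ aS bU)).
Qed.

(** * Edges and passage times of paths in the complete graph *)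

Definition joins {n} (e : edge n) (i j : 'I_n) : bool :=
  (val e == (i, j)) || (val e == (j, i)).

Lemma joinsC {n} (e : edge n) : symmetric (joins e).
Proof. by move=> i j; rewrite /joins orbC. Qed.

(** Edges are stored as increasing pairs, so [(i, j)] and [(j, i)] cannot both be edges. *)
Lemma joins_inj {n} (e e' : edge n) (i j : 'I_n) :
  joins e i j -> joins e' i j -> e = e'.
Proof.
move=> h h'; apply/val_inj; have := valP e; have := valP e'; move: h h'.
by move=> /orP[] /eqP-> /orP[] /eqP-> //= ij ji; have := ltn_trans ij ji; rewrite ltnn.
Qed.

Lemma joins_exists {n} (i j : 'I_n) : i != j -> exists e : edge n, joins e i j.
Proof.
rewrite -(inj_eq val_inj) neq_ltn => /orP[] ij.
  by exists (exist (fun e : 'I_n * 'I_n => (e.1 < e.2)%N) (i, j) ij); rewrite /joins eqxx.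
by exists (exist (fun e : 'I_n * 'I_n => (e.1 < e.2)%N) (j, i) ij); rewrite /joins eqxx orbT.
Qed.

Lemma mem_path_edges {n} (e : edge n) (s : seq 'I_n) :
  e \in path_edges s = has (fun ij => joins e ij.1 ij.2) (zip s (behead s)).
Proof.
rewrite inE /joins; case: (val e) => i j; apply/orP/hasP => [[]ijs|].
- by exists (i, j); rewrite // eqxx.
- by exists (j, i); rewrite // eqxx orbT.
- by move=> [[a b] abs /= /orP[] /eqP[-> ->]]; [left|right].
Qed.

Lemma path_edges_cons {n} (x y : 'I_n) (s : seq 'I_n) (e : edge n) :
  joins e x y -> path_edges [:: x, y & s] = (e |: path_edges (y :: s))%SET.
Proof.
move=> exy; apply/setP => e'; rewrite in_setU1 !mem_path_edges /=; congr (_ || _).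
by apply/idP/eqP => [/joins_inj/(_ exy)|->].
Qed.

Lemma zip_behead_mem (T : eqType) (a b : T) (s : seq T) :
  (a, b) \in zip s (behead s) -> a \in s /\ b \in s.
Proof.
elim: s => //= x [|y s] //= IHs; rewrite !inE => /orP[/eqP[-> ->]|/IHs[as_ bs]].
  by rewrite !eqxx orbT.
by rewrite -!(in_cons y) as_ bs !orbT.
Qed.

Lemma path_edges_notin {n} (x y : 'I_n) (s : seq 'I_n) (e : edge n) :
  joins e x y -> x \notin s -> e \notin path_edges s.
Proof.
move=> exy xs; apply/negP; rewrite mem_path_edges => /hasP[[a b] /zip_behead_mem[as_ bs]] /= eab.
move: exy eab; rewrite /joins.
by move=> /orP[] /eqP-> /orP[] /eqP[? ?]; subst; rewrite ?as_ ?bs in xs.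
Qed.

(** The sum runs over a set of edges; the first edge splits off because [x] is never revisited, so
    that this edge cannot recur. *)
Lemma passage_time_cons {R : realType} {n} (t : edge n -> R) (x y : 'I_n) (s : seq 'I_n) :
  uniq [:: x, y & s] -> exists e, joins e x y /\
    passage_time t [:: x, y & s] = t e + passage_time t (y :: s).
Proof.
rewrite cons_uniq => /andP[xs _].
have [|e exy] := @joins_exists n x y; first by move: xs; rewrite inE negb_or => /andP[].
exists e; split => //; rewrite /passage_time (path_edges_cons _ exy).
by rewrite big_setU1 //; exact: path_edges_notin exy xs.
Qed.

Lemma passage_time_le {R : realType} {n} (t : edge n -> R) (c : R) (x : 'I_n) (s : seq 'I_n) :
  (forall e, t e <= c) -> uniq (x :: s) -> passage_time t (x :: s) <= c * (size s)%:R.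
Proof.
move=> tc; elim: s x => [|y s IHs] x xs.
  by rewrite mulr0 /passage_time big1// => e; rewrite mem_path_edges.
have [e [_ ->]] := passage_time_cons t xs.
by rewrite -natr1 mulrDr mulr1 addrC lerD// IHs//; case/andP: xs.
Qed.

Lemma passage_time_behead {R : realType} {n} (t : edge n -> R) (x : 'I_n) (s : seq 'I_n) :
  (forall e, 0 <= t e) -> uniq (x :: s) -> passage_time t s <= passage_time t (x :: s).
Proof.
move=> t0; case: s => [|y s] xs.
  by rewrite /passage_time !big1// => e; rewrite mem_path_edges.
by have [e [_ ->]] := passage_time_cons t xs; rewrite lerDr.
Qed.

(** * Heavy edges and deterministic bounds on the last passage time *)

Definition heavy {R : realType} {n} (t : edge n -> R) (c : R) : rel 'I_n :=
  fun i j => [exists e : edge n, joins e i j && (c < t e)].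

Lemma heavyC {R : realType} {n} (t : edge n -> R) (c : R) : symmetric (heavy t c).
Proof. by move=> i j; apply: eq_existsb => e; rewrite joinsC. Qed.

(** The edges along [x :: p] are heavy and number [size p]; the last one, into [z], enters only
    through nonnegativity of the weights. *)
Lemma passage_time_ge {R : realType} {n} (t : edge n -> R) (c : R) (x z : 'I_n) (p : seq 'I_n) :
  (forall e, 0 <= t e) -> path (heavy t c) x p -> uniq (x :: rcons p z) ->
  c * (size p)%:R <= passage_time t (x :: rcons p z).
Proof.
move=> t0; elim: p x => [|y p IHp] x /=.
  by rewrite mulr0 => *; exact: sumr_ge0.
move=> /andP[/existsP[e /andP[exy ce]] yp] xs.
have [e' [/joins_inj/(_ exy)-> ->]] := passage_time_cons t xs.
by rewrite -natr1 mulrDr mulr1 addrC lerD// ?(ltW ce)// IHp//; case/andP: xs.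
Qed.

Lemma passage_time_le_sum {R : realType} {n} (t : edge n -> R) (s : seq 'I_n) :
  passage_time t s <= \sum_e `|t e|.
Proof.
rewrite /passage_time big_mkcond /=; apply: ler_sum => e _.
by case: ifP => // _; exact: ler_norm.
Qed.

(** [sup] has its intended meaning on nonempty bounded sets: the one-edge path gives nonemptiness,
    and the sum of all absolute weights bounds every path. *)
Lemma has_sup_passage_time {R : realType} {n} (t : edge n -> R) : (2 <= n)%N ->
  has_sup [set passage_time t s | s in self_avoiding n].
Proof.
move=> n2; split; last first.
  by exists (\sum_e `|t e|) => _ [s _ <-]; exact: passage_time_le_sum.
have n0 : (0 < n)%N by lia.
have n1 : (n.-1 < n)%N by lia.
set p := [:: Ordinal n0; Ordinal n1]; exists (passage_time t p), p => //.
have n01 : Ordinal n0 != Ordinal n1 by rewrite -(inj_eq val_inj) /=; lia.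
exists (Ordinal n0), [:: Ordinal n1]; split => //=.
  by rewrite /complete_adj n01.
by rewrite inE n01.
Qed.

Lemma last_passage_time_ge {R : realType} {n} (t : edge n -> R) (s : seq 'I_n) :
  (2 <= n)%N -> self_avoiding n s -> passage_time t s <= last_passage_time t.
Proof.
move=> n2 sn; apply: ub_le_sup; last by exists s.
by case: (has_sup_passage_time t n2).
Qed.

(** A self-avoiding path has at most [n] vertices, hence fewer than [n] edges; [0 <= c] allows
    rounding their number up to [n]. *)
Lemma last_passage_time_le {R : realType} {n} (t : edge n -> R) (c : R) :
  (2 <= n)%N -> 0 <= c -> (forall e, t e <= c) -> last_passage_time t <= n%:R * c.
Proof.
move=> n2 c0 tc; apply: ge_sup; first by case: (has_sup_passage_time t n2).
move=> _ [_ [x [s [-> _ _ _ xs]]] <-].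
apply: le_trans (passage_time_le tc xs) _; rewrite mulrC ler_wpM2r// ler_nat.
have := uniq_leq_size xs (s2 := enum 'I_n).
by rewrite -cardE card_ord => /(_ (fun x _ => mem_enum _ x)) /ltnW.
Qed.

Lemma uniq_complete_path {n} (x : 'I_n) (s : seq 'I_n) :
  uniq (x :: s) -> path (complete_adj n) x s.
Proof.
elim: s x => //= y s IHs x; rewrite inE negb_or => /andP[/andP[xy _] /IHs->].
by rewrite /complete_adj xy.
Qed.

(** The search runs on the [n - 2] vertices other than the endpoints, and the heavy path found is
    attached to both of them by edges of nonnegative weight. A nonempty path on [size p] vertices
    has one edge fewer, which the strict bound of [dfs_long_path] absorbs. *)
Lemma last_passage_time_dense {R : realType} {n} (t : edge n -> R) (c : R) (k : nat) :
  (2 <= n)%N -> (forall e, 0 <= t e) -> 0 <= c ->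
  (forall A B : {set 'I_n}, {in A, forall x, x \notin B} ->
    #|A| = k -> #|B| = k -> exists a b, [/\ a \in A, b \in B & heavy t c a b]) ->
  c * (n - 2 - 2 * k)%:R <= last_passage_time t.
Proof.
move=> n2 t0 c0 dense.
have n0 : (0 < n)%N by lia.
have n1 : (n.-1 < n)%N by lia.
pose a := Ordinal n0; pose b := Ordinal n1.
have ab : a != b by rewrite -(inj_eq val_inj) /=; lia.
have [p [up pV hp szp]] := dfs_long_path (~: [set a; b])%SET (heavyC t c) dense.
have cV : (#|~: [set a; b]%SET| = n - 2)%N by rewrite cardsCs finset.setCK cards2 ab card_ord.
have ap : a \notin p by apply/negP => /pV; rewrite !inE eqxx.
have bp : b \notin p by apply/negP => /pV; rewrite !inE eqxx orbT.
have abp : uniq (a :: rcons p b).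
  by rewrite /= mem_rcons inE negb_or ab ap rcons_uniq bp up.
have abW : passage_time t (a :: rcons p b) <= last_passage_time t.
  apply: last_passage_time_ge => //; exists a, (rcons p b); split => //.
    by rewrite last_rcons.
  exact: uniq_complete_path.
apply: le_trans abW; case: p => [|x p] in up pV hp szp ap bp abp *.
  (* An empty path means [n - 2 < 2 * k], and truncated subtraction makes the left side zero. *)
  suff -> : (n - 2 - 2 * k = 0)%N by rewrite mulr0; exact: sumr_ge0.
  by apply/eqP; rewrite subn_eq0 -cV ltnW.
apply: le_trans (passage_time_behead t0 abp).
apply: le_trans (passage_time_ge t0 hp _); last by case/andP: abp.
by rewrite ler_wpM2l// ler_nat leq_subLR -cV addnC -ltnS.
Qed.

(** * Counting the edges between two vertex sets *)

Definition crossing {n} (A B : {set 'I_n}) : {set edge n} :=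
  [set e : edge n | [exists a in A, [exists b in B, joins e a b]]]%SET.

(** Orient each edge so that an endpoint in [A] comes first: by disjointness every pair of [A] times
    [B] is then the image of a crossing edge. *)
Lemma card_crossing {n} (A B : {set 'I_n}) :
  {in A, forall x, x \notin B} -> (#|A| * #|B| <= #|crossing A B|)%N.
Proof.
move=> AB; rewrite -cardsX.
pose orient (e : edge n) := if (val e).1 \in A then val e else ((val e).2, (val e).1).
apply: leq_trans (leq_imset_card orient _); apply: subset_leq_card; apply/fintype.subsetP => -[a b].
rewrite inE /= => /andP[aA bB].
have [|e eab] := @joins_exists n a b; first by apply/eqP => ab; have := AB a aA; rewrite ab bB.
apply/imsetP; exists e.
  by rewrite inE; apply/existsP; exists a; rewrite aA; apply/existsP; exists b; rewrite bB.
rewrite /orient; case/orP: eab => /eqP -> /=; first by rewrite aA.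
by rewrite (contraTF (AB b)).
Qed.

(** * Measurability of the last passage time *)

Lemma measurable_last_passage_time {R : realType} {n} (d : measure_display)
    (T : measurableType d) (X : edge n -> T -> R) :
  (2 <= n)%N -> (forall e, measurable_fun setT (X e)) ->
  measurable_fun setT (fun w => last_passage_time (fun e => X e w)).
Proof.
move=> n2 mX; apply: (measurability _ (RGenOInfty.measurableE R)) => // _ [_ [x ->] <-].
(* The supremum exceeds [x] exactly when some path does; the union runs over all vertex sequences,
   countably many, and those that are not self-avoiding paths contribute the empty set. *)
rewrite setTI (_ : _ @^-1` _ = \bigcup_s
   [set w | self_avoiding n s /\ x < passage_time (fun e => X e w) s]); last first.
  apply/seteqP; split => w /=; rewrite in_itv/= andbT.
    have [ne _] := has_sup_passage_time (fun e => X e w) n2.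
    by move=> /(sup_gt ne)[_ [s sn <-] xs]; exists s.
  by move=> [s _ [sn xs]]; apply: lt_le_trans xs _; exact: last_passage_time_ge.
apply: countable_bigcupT_measurable; first exact: countableP.
move=> s; have [sn|sn] := pselect (self_avoiding n s); last first.
  by rewrite (_ : [set _ | _] = set0)//; apply/seteqP; split => w //= [].
have mpt : measurable_fun setT (fun w => passage_time (fun e => X e w) s).
  rewrite (_ : (fun w => _) = fun w => \sum_(e <- enum (path_edges s)) X e w).
    exact: measurable_sum.
  by apply/funext => w; rewrite big_enum.
rewrite (_ : [set _ | _] = setT `&` (fun w => passage_time (fun e => X e w) s) @^-1` `]x, +oo[).
  exact: mpt.
by apply/seteqP; split => w /=; rewrite in_itv/= andbT => -[].
Qed.

Lemma measurable_last_passage_time_itv {R : realType} {n} (d : measure_display)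
    (T : measurableType d) (X : edge n -> T -> R) (a b : R) :
  (2 <= n)%N -> (forall e, measurable_fun setT (X e)) ->
  measurable [set w | a <= last_passage_time (fun e => X e w) <= b].
Proof.
move=> n2 mX; have mL := measurable_last_passage_time n2 mX.
rewrite (_ : [set w | _] = setT `&` (fun w => last_passage_time (fun e => X e w)) @^-1` `[a, b]).
  exact: mL.
by rewrite setTI; apply/seteqP; split => w /=; rewrite in_itv.
Qed.

(** * Probability estimates *)

Lemma prob_bigcup_fin_le {R : realType} (d : measure_display)
    (T : measurableType d) (P : probability T R) (I : finType) (F : I -> set T) :
  (forall i, measurable (F i)) -> (P (\bigcup_i F i) <= \sum_i P (F i))%E.
Proof.
move=> mF.
rewrite (_ : \bigcup_i F i = \big[setU/set0]_i F i).
  (* Measurability is carried along because subadditivity for two sets requires it. *)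
  suff [] : measurable (\big[setU/set0]_i F i) /\ (P (\big[setU/set0]_i F i) <= \sum_i P (F i))%E by [].
  elim/big_ind2 : _ => [|A x B y [mA Ax] [mB By]|i _]; first by rewrite measure0.
    split; first exact: measurableU.
    by apply: le_trans (measureU2 _ mA mB) _; exact: leeD.
  by split.
by rewrite -bigcup_seq; apply/seteqP; split => w [i _ Fi]; exists i => //=; rewrite mem_index_enum.
Qed.

Lemma preimage_le {R : realType} {T : Type} (X : T -> R) (c : R) :
  [set w | X w <= c] = X @^-1` `]-oo, c].
Proof. by apply/seteqP; split => w /=; rewrite in_itv. Qed.

Lemma preimage_gt {R : realType} {T : Type} (X : T -> R) (c : R) :
  [set w | c < X w] = X @^-1` `]c, +oo[.
Proof. by apply/seteqP; split => w /=; rewrite in_itv/= andbT. Qed.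

Lemma measurable_RV_le {R : realType} (d : measure_display) (T : measurableType d)
    (P : probability T R) (X : {RV P >-> R}) (c : R) : measurable [set w | X w <= c].
Proof. by rewrite preimage_le; exact: measurable_funPTI. Qed.

Lemma measurable_RV_gt {R : realType} (d : measure_display) (T : measurableType d)
    (P : probability T R) (X : {RV P >-> R}) (c : R) : measurable [set w | c < X w].
Proof. by rewrite preimage_gt; exact: measurable_funPTI. Qed.

(** With [J] the edges crossing between two vertex sets, this is the probability that none of them
    is heavy. *)
Lemma prob_all_le {R : realType} (d : measure_display) (T : measurableType d)
    (P : probability T R) (I : finType) (X : I -> {RV P >-> R}) (c h : R) (J : {set I}) :
  mutually_independent X -> (forall i, ccdf (X i) c = h%:E) ->
  P (\bigcap_(i in [set` J]) [set w | X i w <= c]) = ((1 - h) ^+ #|J|)%:E.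
Proof.
move=> Xind Xh.
rewrite (_ : \bigcap_(i in _) _ = \bigcap_(i in [set` J]) (X i @^-1` `]-oo, c])); last first.
  by apply: eq_bigcapr => i _; apply/seteqP; split => w /=; rewrite in_itv.
rewrite (Xind J (fun=> `]-oo, c]%classic))//.
under eq_bigr => i _.
  rewrite (_ : P _ = (1 - h)%:E); last by have := cdf_1_ccdf (X i) c; rewrite Xh.
  over.
by rewrite /= prodEFin prodr_const.
Qed.


Lemma prob_gt {R : realType} (d : measure_display) (T : measurableType d)
    (P : probability T R) (X : {RV P >-> R}) (c : R) :
  P [set w | c < X w] = ccdf X c.
Proof. by rewrite preimage_gt. Qed.

Lemma prob_le_npos {R : realType} (d : measure_display) (T : measurableType d)
    (P : probability T R) (X : {RV P >-> R}) (c : R) :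
  {ae P, forall w, 0 < X w} -> c <= 0 -> P [set w | X w <= c] = 0.
Proof.
move=> X_pos c0; apply: measure_negligible; first exact: measurable_RV_le.
by apply: negligibleS X_pos => w /= Xc; apply/negP; rewrite -leNgt (le_trans Xc).
Qed.

(** Used through its contrapositive: a tail value below one forces a positive argument, which yields
    [0 <= f n]. *)
Lemma ccdf_npos {R : realType} (d : measure_display) (T : measurableType d)
    (P : probability T R) (X : {RV P >-> R}) (c : R) :
  {ae P, forall w, 0 < X w} -> c <= 0 -> ccdf X c = 1%:E.
Proof.
move=> X_pos c0; rewrite ccdf_1_cdf (_ : cdf X c = 0) ?sube0//.
by rewrite -(prob_le_npos X_pos c0) preimage_le.
Qed.

(** Three bad events are discarded: a nonpositive weight, of probability zero; a weight above [b];
    and two disjoint [k]-sets without a heavy crossing edge. Off their union the deterministic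
    bounds apply. *)
Lemma prob_last_passage_time_ge {R : realType} {n} (d : measure_display)
    (T : measurableType d) (P : probability T R) (X : edge n -> {RV P >-> R})
    (c h b hb : R) (k : nat) :
  (2 <= n)%N -> mutually_independent X ->
  (forall e, {ae P, forall w, 0 < X e w}) ->
  (forall e, ccdf (X e) c = h%:E) -> (forall e, ccdf (X e) b = hb%:E) ->
  0 <= c -> 0 <= h <= 1 -> 0 <= hb ->
  (1 - (n%:R ^+ 2 * hb + 4 ^+ n * (1 - h) ^+ (k * k))%:E <=
   P [set w | (c * (n - 2 - 2 * k)%:R <= last_passage_time (fun e => X e w) <= n%:R * b)%R])%E.
Proof.
move=> n2 X_indep X_pos X_h X_hb c0 /andP[h0 h1] hb0.
have mX e : measurable_fun setT (X e) by [].
have mle e x : measurable [set w | X e w <= x] by exact: measurable_RV_le.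
have mgt e x : measurable [set w | x < X e w] by exact: measurable_RV_gt.
pose N := \bigcup_e [set w | X e w <= 0].
pose U := \bigcup_e [set w | b < X e w].
pose sparse (AB : {set 'I_n} * {set 'I_n}) := \bigcap_(e in [set` crossing AB.1 AB.2]) [set w | X e w <= c].
pose adm (AB : {set 'I_n} * {set 'I_n}) :=
  [&& [forall x in AB.1, x \notin AB.2], #|AB.1| == k & #|AB.2| == k].
pose D := \bigcup_AB (if adm AB then sparse AB else set0).
have mN : measurable N by apply: fin_bigcup_measurable.
have mU : measurable U by apply: fin_bigcup_measurable.
have mD1 AB : measurable (if adm AB then sparse AB else set0).
  by case: ifP => // _; apply: fin_bigcap_measurable.
have mD : measurable D by apply: fin_bigcup_measurable.
have PN : (P N <= 0)%E.
  apply: le_trans (prob_bigcup_fin_le _ _) _ => //.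
  by rewrite big1// => e _; exact: prob_le_npos.
have PU : (P U <= (n%:R ^+ 2 * hb)%:E)%E.
  apply: le_trans (prob_bigcup_fin_le _ _) _ => //.
  rewrite (eq_bigr (fun=> hb%:E)); last by move=> e _; rewrite prob_gt.
  rewrite sumEFin lee_fin sumr_const -[hb *+ _]mulr_natl ler_wpM2r// -natrX ler_nat.
  (* Edges inject into ordered pairs of vertices, so there are at most [n ^ 2] of them. *)
  rewrite (leq_trans (leq_card (val : edge n -> _) val_inj))//.
  by rewrite card_prod card_ord mulnn.
have PD : (P D <= (4 ^+ n * (1 - h) ^+ (k * k))%:E)%E.
  apply: le_trans (prob_bigcup_fin_le _ _) _ => //.
  (* Every pair of vertex sets, admissible or not, is charged the same amount; there are
     [2 ^ n * 2 ^ n = 4 ^ n] pairs. *)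
  apply: (@le_trans _ _ (\sum_(AB : {set 'I_n} * {set 'I_n}) ((1 - h) ^+ (k * k))%:E)%E).
    apply: lee_sum => AB _; case: ifPn => [/and3P[/forall_inP disj /eqP cA /eqP cB]|_].
      (* At least [k * k] edges cross, and [1 - h] lies between 0 and 1, so lowering the exponent to
         [k * k] can only increase the power. *)
      rewrite (prob_all_le _ X_indep X_h) lee_fin -{1}cA -cB ler_wiXn2l//; try lra.
      by apply: card_crossing.
    by rewrite measure0 lee_fin exprn_ge0//; lra.
  rewrite sumEFin lee_fin sumr_const -[_ *+ #|_|]mulr_natl ler_wpM2r ?exprn_ge0//; first lra.
  rewrite card_prod -cardsT -powersetT card_powerset cardsT card_ord natrM natrX -exprMn.
  by rewrite -natrM.
pose L w := last_passage_time (fun e => X e w).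
have mL : measurable [set w | c * (n - 2 - 2 * k)%:R <= L w <= n%:R * b].
  exact: measurable_last_passage_time_itv.
have mB : measurable (N `|` (U `|` D)) by do ?apply: measurableU.
apply: (@le_trans _ _ (P (~` (N `|` (U `|` D))))); last first.
  apply: le_measure; rewrite ?inE//; first exact: measurableC.
  move=> w /not_orP[Nw /not_orP[Uw Dw]] /=.
  have X0 e : 0 < X e w by rewrite ltNge; apply/negP => Xe; apply: Nw; exists e.
  have Xb e : X e w <= b by rewrite leNgt; apply/negP => Xe; apply: Uw; exists e.
  (* The upper bound needs [0 <= b], which follows from [0 < X e w <= b] at any edge; one exists
     since [2 <= n]. *)
  have [e _] : exists e : edge n, joins e (Ordinal (ltnW n2)) (Ordinal n2).
    by apply: joins_exists.
  have b0 : 0 <= b := le_trans (ltW (X0 e)) (Xb e).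
  rewrite last_passage_time_le// andbT.
  apply: last_passage_time_dense => // [f|A B AB cA cB]; first exact: ltW.
  apply: contrapT => noAB; apply: Dw; exists (A, B) => //.
  have -> : adm (A, B).
    by rewrite /adm /= cA cB !eqxx !andbT; exact/forall_inP.
  move=> f /=; rewrite inE => /existsP[x /andP[xA /existsP[y /andP[yB fxy]]]].
  rewrite leNgt; apply/negP => cf; apply: noAB; exists x, y; split => //.
  by apply/existsP; exists f; rewrite fxy.
rewrite probability_setC// leeB//.
apply: le_trans (measureU2 _ mN (measurableU _ _ mU mD)) _.
rewrite EFinD -[leRHS]add0e leeD//; apply: le_trans (measureU2 _ mU mD) _.
exact: leeD.
Qed.

(** * Choice of [k] and asymptotics of the failure probability *)

Lemma log_density_bound {R : realType} (dl : R) (n : nat) :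
  0 < dl <= 1 -> 8 / dl <= n%:R -> expR (256 / dl ^+ 2) <= n%:R ->
  let k := Num.truncn (dl * n%:R / 4) in
  (1 - dl) * n%:R <= (n - 2 - 2 * k)%:R /\
  4 ^+ n * (1 - ln n%:R / n%:R) ^+ (k * k) <= n.+1%:R^-1 :> R.
Proof.
move=> /andP[dl0 dl1] n8 nexp k.
have n_gt0 : 0 < n%:R :> R by apply: lt_le_trans n8; rewrite divr_gt0.
have dn8 : 8 <= dl * n%:R by rewrite mulrC -ler_pdivrMr.
have k_le : k%:R <= dl * n%:R / 4 :> R.
  by rewrite truncn_le divr_ge0 ?mulr_ge0 ?ltW.
(* Rounding down loses at most 1, and [dl * n / 8 >= 1] because [dl * n >= 8]. *)
have k_ge : dl * n%:R / 8 <= k%:R :> R.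
  by have := truncnS_gt (dl * n%:R / 4); rewrite -/k -(natr1 k); lra.
split.
  rewrite -subnDA; have nle : (2 + 2 * k <= n)%N.
    by rewrite -(ler_nat R) natrD natrM; nra.
  by rewrite natrB// natrD natrM; lra.
have ln_ge : 256 / dl ^+ 2 <= ln n%:R :> R.
  by rewrite -[leLHS]expRK ler_ln// posrE expR_gt0.
have dl2 : 0 < dl ^+ 2 by rewrite exprn_gt0.
have exp4 : 4 <= expR 3 :> R by apply: le_trans (expR_ge1Dx _); lra.
set p := ln n%:R / n%:R.
(* As [k >= dl * n / 8], the right side is at least [ln n * dl ^ 2 * n / 64]; the constant 256 makes
   this at least [4 * n], enough to beat [4 ^ n <= expR (3 * n)]. *)
have pk : 4 * n%:R <= p * (k * k)%:R :> R.
  have -> : p * (k * k)%:R = ln n%:R * (k%:R ^+ 2 / n%:R) by rewrite natrM /p; field; lra.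
  apply: (@le_trans _ _ (256 / dl ^+ 2 * ((dl * n%:R / 8) ^+ 2 / n%:R))).
    by rewrite le_eqVlt; apply/orP; left; apply/eqP; field; lra.
  apply: ler_pM => //; rewrite ?divr_ge0 ?exprn_ge0//; try lra.
  by rewrite ler_pM2r ?invr_gt0// lerXn2r// nnegrE; lra.
(* The base must be nonnegative for [1 - p <= expR (- p)] to be raised to a power. *)
have p1 : 0 <= 1 - p.
  by rewrite subr_ge0 ler_pdivrMr// mul1r ltW// ln_sublinear.
apply: (@le_trans _ _ (expR 3 ^+ n * expR (- p) ^+ (k * k))).
  apply: ler_pM; rewrite ?exprn_ge0//; try lra.
    by rewrite lerXn2r// nnegrE; lra.
  by rewrite lerXn2r// ?nnegrE ?expR_ge0//; exact: expR_ge1Dx.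
rewrite -!expRM_natr -expRD.
(* The exponent is at most [3 * n - 4 * n = - n], and [expR n >= n + 1]. *)
apply: (@le_trans _ _ (expR (- n%:R))); first by rewrite ler_expR; lra.
rewrite expRN lef_pV2 ?posrE ?expR_gt0// -(natr1 n) addrC; exact: expR_ge1Dx.
Qed.

Theorem theorem1p2 (R : realType) (d : nat -> measure_display)
    (T : forall n, measurableType (d n))
    (P : forall n, probability (T n) R)
    (X : forall n, edge n -> {RV (P n) >-> R})
    (H : R -> R) (f g : nat -> R)
    (X_indep : forall n, mutually_independent (X n))
    (X_ident : forall m n (e : edge m) (e' : edge n),
       same_law (X m e) (X n e'))
    (X_pos : forall n (e : edge n), {ae P n, forall w, 0 < X n e w})
    (H_tail : forall n (e : edge n) (x : R), ccdf (X n e) x = (H x)%:E)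
    (mu_infinite : ereal_inf [set x%:E | x in [set x : R | H x = 0]] = +oo%E)
    (f_tail : \forall n \near \oo, H (f n) = ln (n%:R : R) / n%:R)
    (g_tail : (fun n : nat => n%:R ^+ 2 * H (g n)) @ \oo --> (0 : R))
    (eps : R) (eps_gt0 : 0 < eps) :
  (fun n : nat => P n [set w |
     (1 - eps) * f n <= last_passage_time (fun e => X n e w) / n%:R <= g n])
  @ \oo --> 1%E.
Proof.
(* [eps] may exceed 1, whereas the choice of [k] needs a parameter in [(0, 1]]; since [f n] is
   eventually nonnegative, a smaller parameter only strengthens the lower bound. *)
pose dl : R := Num.min eps 1.
have dl01 : 0 < dl <= 1 by rewrite lt_min eps_gt0 ltr01 ge_min lexx orbT.
(* The lower barrier subtracts bounds for the two failure probabilities: some weight above [g n],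
   and two [k]-sets without a heavy crossing edge. *)
apply: (@squeeze_cvge _ _ _ _
  (fun n => (1 - (n%:R ^+ 2 * H (g n) + n.+1%:R^-1))%:E) _ (cst 1%E)).
- near=> n.
  have n2 : (2 <= n)%N by near: n; exact: nbhs_infty_ge.
  have Hf : H (f n) = ln n%:R / n%:R by near: n.
  have n_gt0 : 0 < n%:R :> R by rewrite ltr0n (leq_trans _ n2).
  have [|e _] := @joins_exists n (Ordinal (ltnW n2)) (Ordinal n2); first by [].
  have H01 x : 0 <= H x <= 1.
    by rewrite -!lee_fin -(H_tail n e x) measure_ge0 probability_le1.
  have [] := @log_density_bound R dl n dl01.
  - by near: n; exact: nbhs_infty_ger.
  - by near: n; exact: nbhs_infty_ger.
  set k := Num.truncn _ => nk; rewrite -Hf => small.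
  (* A negative [f n] would have tail 1, but [ln n / n < 1]. *)
  have f0 : 0 <= f n.
    rewrite leNgt; apply/negP => fn0; have : H (f n) < 1.
      by rewrite Hf ltr_pdivrMr// mul1r ln_sublinear.
    by rewrite -lte_fin -(H_tail n e) (ccdf_npos (X_pos n e) (ltW fn0)) lte_fin ltxx.
  set E := [set w | _].
  have -> : E = [set w | (1 - eps) * f n * n%:R <= last_passage_time (fun e => X n e w) <= n%:R * g n].
    by apply/seteqP; split => w; rewrite /E /= ler_pdivlMr// ler_pdivrMr// (mulrC (g n)).
  apply/andP; split; last first.
    by apply: probability_le1; apply: measurable_last_passage_time_itv.
  have /andP[Hg0 _] := H01 (g n).
  have ge := prob_last_passage_time_ge k n2 (X_indep n) (X_pos n)
    (fun e => H_tail n e (f n)) (fun e => H_tail n e (g n)) f0 (H01 (f n)) Hg0.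
  apply: le_trans (le_trans _ ge) _.
    by rewrite -EFinB lee_fin lerD2l lerN2 lerD2l.
  apply: le_measure; rewrite ?inE; try exact: measurable_last_passage_time_itv.
  (* Since [0 <= f n] and [dl <= eps], the lower endpoint [f n * (n - 2 - 2 * k)] dominates
     [(1 - eps) * f n * n]. *)
  move=> w /= /andP[lo ->]; rewrite andbT (le_trans _ lo)// mulrAC mulrC.
  apply: ler_wpM2l => //; apply: le_trans nk; rewrite ler_wpM2r ?ler0n//.
  by rewrite lerD2l lerN2 ge_min lexx.
- apply: cvg_EFin; first exact: nearW.
  have : (fun n => 1 - (n%:R ^+ 2 * H (g n) + harmonic n)) @ \oo --> (1 - (0 + 0) : R).
    by apply: cvgB; [exact: cvg_cst|apply: cvgD; [exact: g_tail|exact: cvg_harmonic]].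
  by rewrite addr0 subr0.
- exact: cvg_cst.
Unshelve. all: by end_near.
Qed.
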